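(* For any positive mass $m_1>0$, there exists a unique rhombus-shaped central configuration $$q_0=[0,\,a,\,-1,\,0,\,0,\,-a,\,1,\,0],\qquad a\in\left(\tfrac{\sqrt3}{3},\sqrt3\right),$$ corresponding to the mass vector $m_0=[m_1,1,m_1,1]$. Moreover, all such rhombus central configurations are nondegenerate for any four positive masses $m_0=[m_1,1,m_1,1]$.
   Context: A planar configuration of $N$ bodies is $q=(q_1,\dots,q_N)\in\mathbb{R}^{2N}$, $q_i=(x_i,y_i)^T\in\mathbb{R}^2$, written as $(x_1,y_1,\dots,x_N,y_N)^T$, with $q_i\ne q_j$ for $i\neq j$. For positive masses $m=(m_1,\dots,m_N)$ define $F(q,m)=[F_1,\dots,F_N]^T\in\mathbb{R}^{2N}$ by $$F_i(q,m)=\sum_{j\ne i}\frac{m_im_j(q_j-q_i)}{\|q_j-q_i\|^3}+\frac{U(q)}{I(q)}\,m_i(q_i-c),$$ where $U(q)=\sum_{i<j}\frac{m_im_j}{\|q_i-q_j\|}$, $I(q)=\sum_{i}m_i\|q_i-c\|^2$, $c=\frac{\sum_i m_iq_i}{\sum_i m_i}$. The configuration $q_0$ is a central configuration for $m_0$ if $F(q_0,m_0)=0$. Let $\mathrm{Jac}(F)|_{(q_0,m_0)}$ be the $2N\times 2N$ Jacobian of $F$ with respect to $q$ at $(q_0,m_0)$ (with $U,I,c$ regarded as functions of $q$). Nondegeneracy (Form IV): for a central configuration $q_0=(x_1,y_1,\dots,x_N,y_N)^T$ for $m_0$, let $B$ be the $2N\times4$ matrix whose columns are $(1,0,1,0,\dots,1,0)^T$,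 $(0,1,0,1,\dots,0,1)^T$, $(-y_1,x_1,\dots,-y_N,x_N)^T$, $(x_1,y_1,\dots,x_N,y_N)^T$ (translations, rotation, scaling), let $B_1$ be its first four rows and $B_2$ its remaining $2N-4$ rows, and let $P=\begin{bmatrix} B_1 & 0 \\ B_2 & \mathrm{Id} \end{bmatrix}$ with $\mathrm{Id}$ the identity of size $2N-4$ (this $P$ is invertible since $q_1\ne q_2$). Then $P^{-1}\mathrm{Jac}(F)|_{(q_0,m_0)}P=\begin{bmatrix} 0 & J_1 \\ 0 & J_2 \end{bmatrix}$ with $J_2$ of size $(2N-4)\times(2N-4)$. The central configuration $q_0$ is nondegenerate if $\det J_2\neq0$ and degenerate otherwise. Here $N=4$: bodies 1 and 3, of mass $m_1$, are at $(0,a)$ and $(0,-a)$, and bodies 2 and 4, of mass $1$, are at $(-1,0)$ and $(1,0)$. *)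

(* Defs.v *)
From HB Require Import structures.
From mathcomp Require Import all_boot all_order all_algebra.
From mathcomp Require Import all_classical all_reals all_analysis.
Import Order.TTheory GRing.Theory Num.Theory.
Import numFieldNormedType.Exports.

Set Implicit Arguments.
Unset Strict Implicit.
Unset Printing Implicit Defensive.

Local Open Scope ring_scope.

(* The number of bodies is N = n.+2, so that a configuration
   (x_1, y_1, ..., x_N, y_N) is a vector of size 2N = 4 + 2n, already split as
   the 4 + (2N - 4) needed by the block decomposition of the Jacobian.
   With 0-based indices, entry l = 2 i + k is coordinate k of body i. *)

Lemma coord_subproof n (i : 'I_n.+2) (k : 'I_2) : (i.*2 + k < 4 + n.*2)%N.
Proof.
have le_i : (i.*2.+2 <= n.+2.*2)%N by rewrite -doubleS leq_double.
by apply: leq_trans le_i; rewrite -[ltnRHS]addn2 ltn_add2l.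
Qed.

Definition coord_idx n (i : 'I_n.+2) (k : 'I_2) : 'I_(4 + n.*2) :=
  Ordinal (coord_subproof i k).

Lemma body_subproof n (l : 'I_(4 + n.*2)) : (l./2 < n.+2)%N.
Proof. by rewrite ltn_half_double. Qed.

Definition body_idx n (l : 'I_(4 + n.*2)) : 'I_n.+2 :=
  Ordinal (body_subproof l).

Definition axis_idx n (l : 'I_(4 + n.*2)) : 'I_2 :=
  Ordinal (ltn_pmod l (isT : 0 < 2)%N).

Lemma coord_idxK n (l : 'I_(4 + n.*2)) :
  coord_idx (body_idx l) (axis_idx l) = l.
Proof. by apply: val_inj; rewrite /= modn2 addnC odd_double_half. Qed.

Section CentralConfigurations.
Variables (R : realType) (n : nat).
Implicit Types (q : 'rV[R]_(4 + n.*2)) (m : 'rV[R]_n.+2) (i j : 'I_n.+2).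

Definition body_pos q i : 'rV[R]_2 := \row_k q 0 (coord_idx i k).

(* The norm `|v| on matrices is the sup norm. *)
Definition enorm (v : 'rV[R]_2) : R := Num.sqrt (\sum_k v 0 k ^+ 2).

Definition mass_center q m : 'rV[R]_2 :=
  (\sum_i m 0 i)^-1 *: \sum_i m 0 i *: body_pos q i.

Definition potential q m : R :=
  \sum_(i < n.+2) \sum_(j < n.+2 | (i < j)%N)
    m 0 i * m 0 j / enorm (body_pos q i - body_pos q j).

Definition inertia q m : R :=
  \sum_i m 0 i * enorm (body_pos q i - mass_center q m) ^+ 2.

Definition cc_force q m i : 'rV[R]_2 :=
  \sum_(j | j != i)
     (m 0 i * m 0 j / enorm (body_pos q j - body_pos q i) ^+ 3) *:
     (body_pos q j - body_pos q i)
  + (potential q m / inertia q m * m 0 i) *: (body_pos q i - mass_center q m).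

Definition cc_map m q : 'rV[R]_(4 + n.*2) :=
  \row_l cc_force q m (body_idx l) 0 (axis_idx l).

Definition configuration q :=
  forall i j, i != j -> body_pos q i != body_pos q j.

Definition central_configuration q m := configuration q /\ cc_map m q = 0.

(* The library's Jacobian acts on row vectors on the right, hence the
   transpose: entry (l, l') is the derivative of F_l with respect to q_l'. *)
Definition cc_jacobian q m : 'M[R]_(4 + n.*2) := ('J (cc_map m) q)^T.

Definition symmetry_mx q : 'M[R]_(4 + n.*2, 4) :=
  \matrix_(l, c)
    [:: (axis_idx l == 0)%:R;
        (axis_idx l == 1)%:R;
        (if axis_idx l == 0 then - body_pos q (body_idx l) 0 1
         else body_pos q (body_idx l) 0 0);
        q 0 l]`_c.

Definition change_of_basis q : 'M[R]_(4 + n.*2) :=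
  block_mx (usubmx (symmetry_mx q)) 0 (dsubmx (symmetry_mx q)) 1%:M.

Definition J2 q m : 'M[R]_(n.*2) :=
  drsubmx (invmx (change_of_basis q) *m cc_jacobian q m *m change_of_basis q).

(* Meaningful when q is a central configuration for m. *)
Definition nondegenerate_cc q m := \det (J2 q m) != 0.

End CentralConfigurations.

Definition rhombus (R : realType) (a : R) : 'rV[R]_(4 + 2.*2) :=
  \row_l [:: 0; a; -1; 0; 0; - a; 1; 0]`_l.

Definition rhombus_mass (R : realType) (m1 : R) : 'rV[R]_4 :=
  \row_i [:: m1; 1; m1; 1]`_i.

(* Main.v *)
Require Import Defs.
From mathcomp Require Import all_boot all_order all_algebra.
From mathcomp Require Import all_classical all_reals all_analysis.
From mathcomp Require Import ring lra.
Import Order.TTheory GRing.Theory Num.Theory.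
Import numFieldNormedType.Exports.
Set Implicit Arguments.
Unset Strict Implicit.
Unset Printing Implicit Defensive.
Local Open Scope ring_scope.

(* With s = sqrt (1 + a^2) the side of the rhombus, the central configuration
   equations say that U / I equals both m1 / (4 a^3) + 2 / s^3 and
   1 / 4 + 2 m1 / s^3. Equating the two and dividing by a^3 gives an equation
   whose sides are strictly monotone in opposite directions, with a sign change
   between sqrt 3 / 3 and sqrt 3.
   For the nondegeneracy, the two reflections preserving the rhombus split the
   space of variations into four planes, each containing one symmetry direction
   (two translations, scaling, rotation), which the Jacobian kills. As the
   Jacobian is symmetric, on each plane it is k b b^T with b orthogonal to the
   symmetry direction. The bounds on a give s < 2 and s < 2 a, and the two
   expressions of U / I then give k <> 0 for each plane. *)

(** * Differentials of real functions *)

(** Differentiability and the value at [v] are bundled so that the rules below build the value by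
    unification; [has_diff_eq] then replaces it by the wanted closed form. *)
Definition has_diff {R : realType} {V W : normedModType R}
    (f : V -> W) (x v : V) (l : W) :=
  differentiable f x /\ 'd f x v = l.

Section HasDiff.
Variables (R : realType) (V : normedModType R).
Implicit Types (f g : V -> R) (x v : V) (k l : R).

Lemma has_diff_eq f x v k l : has_diff f x v k -> k = l -> has_diff f x v l.
Proof. by move=> + <-. Qed.

Lemma has_diff_cst x v k : has_diff (fun=> k) x v 0.
Proof.
split; first exact: differentiable_cst.
by rewrite (diff_cst k x).
Qed.

Lemma has_diffD f g x v k l : has_diff f x v k -> has_diff g x v l ->
  has_diff (fun y => f y + g y) x v (k + l).
Proof.
move=> [df <-] [dg <-]; split; first exact: differentiableD.
by rewrite (diffD df dg).
Qed.

Lemma has_diffN f x v k : has_diff f x v k -> has_diff (fun y => - f y) x v (- k).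
Proof.
move=> [df <-]; split; first exact: differentiableN.
by rewrite (diffN df).
Qed.

Lemma has_diffM f g x v k l : has_diff f x v k -> has_diff g x v l ->
  has_diff (fun y => f y * g y) x v (k * g x + f x * l).
Proof.
move=> [df <-] [dg <-]; split; first exact: differentiableM.
apply: etrans (congr1 (fun h : V -> R => h v) (diffM df dg)) _.
by rewrite addrC; congr (_ + _); exact: mulrC.
Qed.

Lemma has_diffV f x v k : has_diff f x v k -> f x != 0 ->
  has_diff (fun y => (f y)^-1) x v (- k / f x ^+ 2).
Proof.
move=> [df <-] fx0; split; first exact: differentiableV.
rewrite (diffV df fx0).
by change (- f x ^- 2 * 'd f x v = - 'd f x v / f x ^+ 2); ring.
Qed.

Lemma has_diffX f n x v k : has_diff f x v k ->
  has_diff (fun y => f y ^+ n.+1) x v (n.+1%:R * f x ^+ n * k).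
Proof.
move=> [df <-]; rewrite -(exprfctE f).
by split; [exact: differentiableX | rewrite (diffX n df)].
Qed.

Lemma has_diff_sqrt f x v k : has_diff f x v k -> 0 < f x ->
  has_diff (fun y => Num.sqrt (f y)) x v (k / (2 * Num.sqrt (f x))).
Proof.
move=> [df <-] fx0.
have [dsqrt sqrtE] := is_derive1_sqrt fx0.
have {dsqrt} dsqrt := (derivable1_diffP _ _).1 dsqrt.
split; first exact: (differentiable_comp df dsqrt).
apply: etrans (congr1 (fun h : V -> R => h v) (diff_comp df dsqrt)) _.
by rewrite /= (diff1E dsqrt) derive1E sqrtE.
Qed.

Lemma has_diff_sum (I : Type) (r : seq I) (P : pred I) (F : I -> V -> R)
    x v (D : I -> R) : (forall i, P i -> has_diff (F i) x v (D i)) ->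
  has_diff (fun y => \sum_(i <- r | P i) F i y) x v (\sum_(i <- r | P i) D i).
Proof.
move=> dF; elim: r => [|i r ih].
  by under eq_fun do rewrite big_nil; rewrite big_nil; exact: has_diff_cst.
under eq_fun do rewrite big_cons; rewrite big_cons; case: ifP => // Pi.
exact: has_diffD (dF i Pi) ih.
Qed.

End HasDiff.

Lemma has_diff_coord (R : realType) m n i j (x v : 'M[R]_(m, n)) :
  has_diff (fun y : 'M[R]_(m, n) => y i j) x v (v i j).
Proof.
split; first exact: differentiable_coord.
rewrite -deriveE; last exact: differentiable_coord.
have := derive_mx (@derivable_id _ _ x v); rewrite derive_id => /matrixP /(_ i j).
by rewrite mxE.
Qed.

(** A row vector is the sum of its coordinates times basis vectors, and each summand is a scalar
    function scaling a constant vector. *)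
Lemma has_diff_row (R : realType) (V : normedModType R) n (f : V -> 'rV[R]_n)
    (x v : V) (D : 'rV[R]_n) :
  (forall l, has_diff (fun y => f y 0 l) x v (D 0 l)) -> has_diff f x v D.
Proof.
move=> df.
have -> : f = \sum_(l < n) (fun y => f y 0 l *: delta_mx 0 l).
  by apply/funext => y; rewrite fct_sumE {1}[f y]row_sum_delta.
have dl l : differentiable (fun y => f y 0 l *: delta_mx 0 l : 'rV[R]_n) x.
  by apply: differentiableZl; case: (df l).
split; first exact: differentiable_sum.
rewrite -deriveE; last exact: differentiable_sum.
rewrite derive_sum => [|l]; last exact: diff_derivable.
rewrite [RHS]row_sum_delta; apply: eq_bigr => l _.
rewrite deriveE //; case: (df l) => dfl <-.
by rewrite diffZl.
Qed.

(** * Differential of the force of N bodies *)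

Definition dotv {R : realType} (u v : 'rV[R]_2) : R := \sum_k u 0 k * v 0 k.

Section EuclideanNorm.
Context {R : realType}.
Implicit Types u v : 'rV[R]_2.

Lemma enorm_sqr u : enorm u ^+ 2 = dotv u u.
Proof.
rewrite sqr_sqrtr; first by apply: eq_bigr => k _; rewrite expr2.
by apply: sumr_ge0 => k _; exact: sqr_ge0.
Qed.

Lemma enorm_gt0 u : (0 < enorm u) = (u != 0).
Proof.
rewrite sqrtr_gt0 lt_def sumr_ge0 => [|k _]; last exact: sqr_ge0.
rewrite andbT psumr_eq0 => [|k _]; last exact: sqr_ge0.
congr (~~ _); apply/allP/eqP => [u0|-> k _]; last by rewrite mxE expr0n eqxx.
apply/rowP => k; rewrite mxE; apply/eqP.
by rewrite -sqrf_eq0; apply: u0; rewrite mem_index_enum.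
Qed.

Lemma rowDE u v k : (u + v) 0 k = u 0 k + v 0 k.
Proof. by rewrite mxE. Qed.

Lemma rowZE (c : R) u k : (c *: u) 0 k = c * u 0 k.
Proof. by rewrite mxE. Qed.

Lemma rowBE u v k : (u - v) 0 k = u 0 k - v 0 k.
Proof. by rewrite !mxE. Qed.

End EuclideanNorm.

Section Differential.
Context {R : realType} {n : nat}.
Implicit Types (q v : 'rV[R]_(4 + n.*2)) (m : 'rV[R]_n.+2) (i j : 'I_n.+2).

(* [body_pos] and [mass_center] are linear in the configuration, so that they
   are their own differentials. *)
Definition dpotential q v m : R :=
  - \sum_(i < n.+2) \sum_(j < n.+2 | (i < j)%N)
    m 0 i * m 0 j *
    dotv (body_pos q i - body_pos q j) (body_pos v i - body_pos v j)
    / enorm (body_pos q i - body_pos q j) ^+ 3.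

Definition dinertia q v m : R :=
  2 * \sum_i m 0 i *
    dotv (body_pos q i - mass_center q m) (body_pos v i - mass_center v m).

Definition dmultiplier q v m : R :=
  (dpotential q v m * inertia q m - potential q m * dinertia q v m) /
  inertia q m ^+ 2.

(** Product rule: the factor 3 and the fifth power come from differentiating the inverse cube of the
    norm, and the last two terms vary the multiplier and the offset from the center of mass. *)
Definition dcc_force q v m i : 'rV[R]_2 :=
  \sum_(j | j != i)
    ((m 0 i * m 0 j / enorm (body_pos q j - body_pos q i) ^+ 3) *:
       (body_pos v j - body_pos v i)
     - (m 0 i * m 0 j *
        (3 * dotv (body_pos q j - body_pos q i) (body_pos v j - body_pos v i))
        / enorm (body_pos q j - body_pos q i) ^+ 5) *:
       (body_pos q j - body_pos q i))
  + (dmultiplier q v m * m 0 i) *: (body_pos q i - mass_center q m)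
  + (potential q m / inertia q m * m 0 i) *: (body_pos v i - mass_center v m).

Lemma has_diff_body_pos q v i k :
  has_diff (fun y => body_pos y i 0 k) q v (body_pos v i 0 k).
Proof. by under eq_fun do rewrite mxE; rewrite mxE; exact: has_diff_coord. Qed.

Lemma has_diff_mass_center q v m k :
  has_diff (fun y => mass_center y m 0 k) q v (mass_center v m 0 k).
Proof.
have E y : mass_center y m 0 k =
    (\sum_i m 0 i)^-1 * \sum_i m 0 i * body_pos y i 0 k.
  by rewrite mxE summxE; congr (_ * _); apply: eq_bigr => i _; rewrite mxE.
under eq_fun do rewrite E; rewrite E.
apply: has_diff_eq; first apply: has_diffM; first exact: has_diff_cst.
  apply: has_diff_sum => i _; apply: has_diffM; first exact: has_diff_cst.
  exact: has_diff_body_pos.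
rewrite /= mul0r add0r; congr (_ * _).
by apply: eq_bigr => i _; rewrite mul0r add0r.
Qed.

Lemma has_diff_dotv (f : 'rV[R]_(4 + n.*2) -> 'rV[R]_2) q v (d : 'rV[R]_2) :
  (forall k, has_diff (fun y => f y 0 k) q v (d 0 k)) ->
  has_diff (fun y => dotv (f y) (f y)) q v (2 * dotv (f q) d).
Proof.
move=> df; apply: has_diff_eq.
  by apply: has_diff_sum => k _; apply: has_diffM; exact: df.
by rewrite mulr_sumr; apply: eq_bigr => k _ /=; ring.
Qed.

Lemma has_diff_enorm (f : 'rV[R]_(4 + n.*2) -> 'rV[R]_2) q v (d : 'rV[R]_2) :
  (forall k, has_diff (fun y => f y 0 k) q v (d 0 k)) -> f q != 0 ->
  has_diff (fun y => enorm (f y)) q v (dotv (f q) d / enorm (f q)).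
Proof.
move=> df fq0; have E u : @enorm R u = Num.sqrt (dotv u u).
  by congr Num.sqrt; apply: eq_bigr => k _; rewrite expr2.
under eq_fun do rewrite E.
have e0 : enorm (f q) != 0 by rewrite gt_eqF // enorm_gt0.
apply: has_diff_eq; first apply: has_diff_sqrt (has_diff_dotv df) _.
  by rewrite -enorm_sqr exprn_gt0 // enorm_gt0.
by rewrite -E; field.
Qed.

Lemma has_diff_dist q v i j k :
  has_diff (fun y => (body_pos y i - body_pos y j) 0 k) q v
    ((body_pos v i - body_pos v j) 0 k).
Proof.
under eq_fun do rewrite rowBE; rewrite rowBE.
by apply: has_diffD; [|apply: has_diffN]; exact: has_diff_body_pos.
Qed.

Lemma has_diff_offset q v m i k :
  has_diff (fun y => (body_pos y i - mass_center y m) 0 k) q v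
    ((body_pos v i - mass_center v m) 0 k).
Proof.
under eq_fun do rewrite rowBE; rewrite rowBE; apply: has_diffD.
  exact: has_diff_body_pos.
by apply: has_diffN; exact: has_diff_mass_center.
Qed.

Lemma has_diff_inertia q v m :
  has_diff (fun y => inertia y m) q v (dinertia q v m).
Proof.
(* Squared norms become dot products first, since a body may sit at the center of mass, where the
   norm itself is not differentiable. *)
under eq_fun => y do
  [rewrite /inertia; under eq_bigr => i _ do rewrite enorm_sqr].
apply: has_diff_eq.
  apply: has_diff_sum => i _; apply: has_diffM; first exact: has_diff_cst.
  by apply: has_diff_dotv => k; exact: has_diff_offset.
by rewrite /dinertia mulr_sumr; apply: eq_bigr => i _ /=; ring.
Qed.

Lemma configuration_enorm q i j : configuration q -> i != j ->
  0 < enorm (body_pos q i - body_pos q j).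
Proof. by move=> cq ij; rewrite enorm_gt0 subr_eq0 cq. Qed.

Lemma has_diff_potential q v m : configuration q ->
  has_diff (fun y => potential y m) q v (dpotential q v m).
Proof.
move=> cq; apply: has_diff_eq.
  apply: has_diff_sum => i _; apply: has_diff_sum => j ij.
  have dij : i != j by apply: contraTneq ij => ->; rewrite ltnn.
  have := configuration_enorm cq dij; rewrite enorm_gt0 => qij.
  apply: has_diffM; first exact: has_diff_cst.
  apply: has_diffV; last by rewrite gt_eqF // configuration_enorm.
  by apply: has_diff_enorm => // k; exact: has_diff_dist.
rewrite /dpotential -sumrN; apply: eq_bigr => i _.
rewrite -sumrN; apply: eq_bigr => j ij /=.
have dij : i != j by apply: contraTneq ij => ->; rewrite ltnn.
by have := configuration_enorm cq dij => /lt0r_neq0 e0; field.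
Qed.

Lemma has_diff_cc_force q v m i k : configuration q -> inertia q m != 0 ->
  has_diff (fun y => cc_force y m i 0 k) q v (dcc_force q v m i 0 k).
Proof.
move=> cq I0.
have E y : cc_force y m i 0 k =
    \sum_(j | j != i) m 0 i * m 0 j / enorm (body_pos y j - body_pos y i) ^+ 3 *
      (body_pos y j - body_pos y i) 0 k
    + potential y m / inertia y m * m 0 i * (body_pos y i - mass_center y m) 0 k.
  rewrite mxE summxE; congr (_ + _); last by rewrite mxE.
  by apply: eq_bigr => j _; rewrite mxE.
under eq_fun do rewrite E.
apply: has_diff_eq.
  apply: has_diffD.
    apply: has_diff_sum => j ji; have := configuration_enorm cq ji => qji.
    apply: has_diffM; last exact: has_diff_dist.
    apply: has_diffM; first exact: has_diff_cst.
    apply: has_diffV; last by rewrite expf_neq0 // gt_eqF.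
    apply: has_diffX; apply: has_diff_enorm; last by rewrite -enorm_gt0.
    by move=> l; exact: has_diff_dist.
  apply: has_diffM; last exact: has_diff_offset.
  apply: has_diffM; last exact: has_diff_cst.
  apply: has_diffM; first exact: has_diff_potential.
  by apply: has_diffV => //; exact: has_diff_inertia.
rewrite /= /dcc_force 2![in RHS]rowDE summxE -addrA.
congr (_ + _).
  apply: eq_bigr => j ji; have /lt0r_neq0 := configuration_enorm cq ji.
  rewrite [in RHS]rowBE ![in RHS]rowZE.
  move: (enorm _) (dotv _ _) ((body_pos q j - _) _ _) ((body_pos v j - _) _ _).
  by move=> e d x y e0; field.
rewrite ![in RHS]rowZE /dmultiplier.
move: ((body_pos q i - _) _ _) ((body_pos v i - _) _ _) => x y.
by field.
Qed.

Lemma has_diff_cc_map q v m : configuration q -> inertia q m != 0 ->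
  has_diff (cc_map m) q v (\row_l dcc_force q v m (body_idx l) 0 (axis_idx l)).
Proof.
move=> cq I0; apply: has_diff_row => l; under eq_fun do rewrite mxE.
by rewrite mxE; exact: has_diff_cc_force.
Qed.

(** The Jacobian enters the proof only through directional derivatives, so its matrix of partial
    derivatives is never written down. *)
Lemma mul_jacobian q m (v : 'cV[R]_(4 + n.*2)) :
  configuration q -> inertia q m != 0 ->
  cc_jacobian q m *m v =
    \col_l dcc_force q v^T m (body_idx l) 0 (axis_idx l).
Proof.
move=> cq I0; apply: trmx_inj; rewrite trmx_mul trmxK.
rewrite /jacobian mul_rV_lin1.
have [_ ->] := has_diff_cc_map v^T cq I0.
by apply/rowP => l; rewrite !mxE.
Qed.

End Differential.

(** * Rhombus central configurations *)

Local Notation body k := (@Ordinal 4 k isT).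

Lemma axis_ind (P : 'I_2 -> Prop) : P 0 -> P 1 -> forall k, P k.
Proof.
move=> P0 P1 [[|[|]]] // k_lt.
  by rewrite (_ : Ordinal k_lt = 0) //; exact: val_inj.
by rewrite (_ : Ordinal k_lt = 1) //; exact: val_inj.
Qed.

Lemma body_ind (P : 'I_4 -> Prop) :
  P (body 0) -> P (body 1) -> P (body 2) -> P (body 3) -> forall i, P i.
Proof.
move=> P0 P1 P2 P3 [[|[|[|[|]]]]] // i_lt.
- by rewrite (_ : Ordinal i_lt = body 0) //; exact: val_inj.
- by rewrite (_ : Ordinal i_lt = body 1) //; exact: val_inj.
- by rewrite (_ : Ordinal i_lt = body 2) //; exact: val_inj.
- by rewrite (_ : Ordinal i_lt = body 3) //; exact: val_inj.
Qed.

Lemma body_idxK n (i : 'I_n.+2) (k : 'I_2) : body_idx (coord_idx i k) = i.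
Proof.
by apply: val_inj; case: k => [[|[|]]] //= _;
  rewrite ?addn0 ?addn1 /= ?doubleK ?uphalf_double.
Qed.

Lemma axis_idxK n (i : 'I_n.+2) (k : 'I_2) : axis_idx (coord_idx i k) = k.
Proof.
by apply: val_inj; case: k => [[|[|]]] //= _;
  rewrite ?addn0 ?addn1 modn2 /= odd_double.
Qed.

(** Predicates become conditionals, so that on explicit bodies simplification discards the excluded
    terms. *)
Lemma sum_bodies (R : nmodType) (P : pred 'I_4) (F : 'I_4 -> R) :
  \sum_(i | P i) F i =
    (if P (body 0) then F (body 0) else 0) +
    ((if P (body 1) then F (body 1) else 0) +
    ((if P (body 2) then F (body 2) else 0) +
     (if P (body 3) then F (body 3) else 0))).
Proof.
rewrite big_mkcond /= !big_ord_recl big_ord0 addr0.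
by do ![congr (_ + _)]; congr (if P _ then F _ else _); apply: val_inj.
Qed.

Lemma dotvE (R : realType) (u v : 'rV[R]_2) :
  dotv u v = u 0 0 * v 0 0 + u 0 1 * v 0 1.
Proof.
rewrite /dotv !big_ord_recl big_ord0 addr0.
by congr (_ + _ * _); congr (_ _ _); apply: val_inj.
Qed.

Definition side {R : realType} (a : R) : R := Num.sqrt (1 + a ^+ 2).

Section Rhombus.
Variables (R : realType) (a m1 : R).
Hypotheses (a_gt0 : 0 < a) (m1_gt0 : 0 < m1).
Local Notation s := (side a).
Local Notation q := (rhombus a).
Local Notation m := (rhombus_mass m1).

Lemma side_gt0 : 0 < s.
Proof. by rewrite sqrtr_gt0; nra. Qed.

Lemma side_sqr : s ^+ 2 = 1 + a ^+ 2.
Proof. by rewrite sqr_sqrtr; nra. Qed.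

Lemma rhombus_mass_val i : m 0 i = if odd i then 1 else m1.
Proof. by rewrite mxE; case: i => [[|[|[|[]]]]]. Qed.

(** With 0-based numbering, odd bodies lie on the horizontal axis and even bodies on the vertical
    one, so parity drives all the case distinctions. *)
Lemma rhombus_x i :
  body_pos q i 0 0 = if odd i then i%:R - 2 else 0.
Proof. by rewrite !mxE; case: i => [[|[|[|[|]]]]] //= _; ring. Qed.

Lemma rhombus_y i :
  body_pos q i 0 1 = if odd i then 0 else (1 - i%:R) * a.
Proof. by rewrite !mxE; case: i => [[|[|[|[|]]]]] //= _; ring. Qed.

(** Bodies of different parity are adjacent vertices; distinct bodies of equal parity are the ends
    of a diagonal. *)
Definition rhombus_dist (i j : 'I_4) : R :=
  if odd (i + j) then s else if i == j then 0 else if odd i then 2 else 2 * a.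

Lemma enorm_rhombus i j :
  enorm (body_pos q i - body_pos q j) = rhombus_dist i j.
Proof.
have [a0 s0 s2] := And3 a_gt0 side_gt0 side_sqr.
have d0 : 0 <= rhombus_dist i j.
  by rewrite /rhombus_dist; do ![case: ifP => _] => //; lra.
apply: (@pexpIrn _ 2) => //; first by rewrite nnegrE sqrtr_ge0.
rewrite enorm_sqr dotvE !rowBE !rhombus_x !rhombus_y /rhombus_dist.
by case: i j d0 => [[|[|[|[|]]]]] ? // [[|[|[|[|]]]]] ? //= _; rewrite ?s2; ring.
Qed.

Lemma mass_center_rhombus : mass_center q m = 0.
Proof.
apply/rowP => k; rewrite mxE summxE sum_bodies /= !rowZE !rhombus_mass_val /=.
rewrite [RHS]mxE; elim/axis_ind: k.
  by rewrite !rhombus_x /=; ring.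
by rewrite !rhombus_y /=; ring.
Qed.

Lemma inertia_rhombus : inertia q m = 2 * (m1 * a ^+ 2 + 1).
Proof.
rewrite /inertia mass_center_rhombus sum_bodies /= !subr0 !enorm_sqr !dotvE.
by rewrite !rhombus_mass_val !rhombus_x !rhombus_y /=; ring.
Qed.

Lemma inertia_rhombus_neq0 : inertia q m != 0.
Proof.
have [a0 mu0] := (a_gt0, m1_gt0).
by rewrite inertia_rhombus gt_eqF //; nra.
Qed.

Lemma potential_rhombus :
  potential q m = m1 ^+ 2 / (2 * a) + 1 / 2 + 4 * m1 / s.
Proof.
rewrite /potential sum_bodies /= !sum_bodies /= !enorm_rhombus /rhombus_dist /=.
have s0 := side_gt0.
by rewrite !rhombus_mass_val /=; field; rewrite !gt_eqF.
Qed.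

Lemma configuration_rhombus : configuration q.
Proof.
move=> i j ij; rewrite -subr_eq0 -enorm_gt0 enorm_rhombus /rhombus_dist.
rewrite (negPf ij); case: ifP => _; first exact: side_gt0.
by case: ifP => _ //; rewrite mulr_gt0.
Qed.

Definition rhombus_multiplier : R := potential q m / inertia q m.
Local Notation lam := rhombus_multiplier.

Lemma cc_force_rhombus i k :
  cc_force q m i 0 k =
  m 0 i * (\sum_(j | j != i) m 0 j / rhombus_dist j i ^+ 3 *
     (body_pos q j 0 k - body_pos q i 0 k) + lam * body_pos q i 0 k).
Proof.
rewrite /cc_force mass_center_rhombus subr0 rowDE summxE rowZE mulrDr mulr_sumr.
congr (_ + _); last by rewrite /rhombus_multiplier; ring.
by apply: eq_bigr => j _; rewrite rowZE rowBE enorm_rhombus; ring.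
Qed.

(** By the two reflections, the force components that do not vanish identically reduce to two: the
    vertical one on a body of mass [m1], divided by [m1 * a], and the horizontal one on a body of
    mass 1. *)
Lemma cc_rhombusP :
  central_configuration q m <->
  lam = m1 / (4 * a ^+ 3) + 2 / s ^+ 3 /\ lam = 1 / 4 + 2 * m1 / s ^+ 3.
Proof.
have s0 := side_gt0.
split.
  case=> _ /rowP F0.
  have {}F0 i k : cc_force q m i 0 k = 0.
    by have := F0 (coord_idx i k); rewrite [LHS]mxE [RHS]mxE body_idxK axis_idxK.
  split.
    have := F0 (body 0) 1; rewrite cc_force_rhombus sum_bodies /=.
    rewrite !rhombus_mass_val !rhombus_y /rhombus_dist /= => E.
    apply: (@mulfI _ (m1 * a)); first by rewrite mulf_neq0 ?gt_eqF.
    apply/eqP; rewrite -subr_eq0 -{}E; apply/eqP; field.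
    by rewrite !gt_eqF.
  have := F0 (body 3) 0; rewrite cc_force_rhombus sum_bodies /=.
  rewrite !rhombus_mass_val !rhombus_x /rhombus_dist /= => E.
  apply/eqP; rewrite -subr_eq0 -{}E; apply/eqP; field.
  by rewrite !gt_eqF.
case=> lam1 lam2; split; first exact: configuration_rhombus.
apply/rowP => l; rewrite [LHS]mxE [RHS]mxE cc_force_rhombus.
move: (body_idx l) (axis_idx l) => i k.
elim/axis_ind: k; elim/body_ind: i; rewrite sum_bodies /= !rhombus_mass_val;
  rewrite ?(rhombus_x, rhombus_y) /rhombus_dist /= ?lam1;
  (try by field; rewrite ?gt_eqF);
  by rewrite -lam1 lam2; field; rewrite ?gt_eqF.
Qed.

(** [U / I] is the weighted mean of the two expressions of [cc_rhombusP], with weights [m1 * a ^+ 2]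
    and [1]. Hence it equals both as soon as they agree with each other. *)
Lemma cc_rhombusE :
  central_configuration q m <->
  m1 * (8 * a ^+ 3 - s ^+ 3) = a ^+ 3 * (8 - s ^+ 3).
Proof.
have s0 := side_gt0; rewrite cc_rhombusP.
have a3 : a ^+ 3 != 0 by rewrite expf_neq0 // gt_eqF.
have s3 : s ^+ 3 != 0 by rewrite expf_neq0 // gt_eqF.
have lamE : lam * (m1 * a ^+ 2 + 1) =
    m1 * a ^+ 2 * (m1 / (4 * a ^+ 3) + 2 / s ^+ 3) + (1 / 4 + 2 * m1 / s ^+ 3).
  rewrite /rhombus_multiplier inertia_rhombus potential_rhombus.
  (* [field] treats [s] and [a] as independent, so the relation [s ^+ 2 = 1 + a ^+ 2] is used by
     hand. *)
  have -> : 4 * m1 / s = 4 * m1 * (1 + a ^+ 2) / s ^+ 3.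
    by rewrite -side_sqr; field; rewrite gt_eqF.
  have [a0 mu0] := (a_gt0, m1_gt0).
  by field; rewrite !gt_eqF //; nra.
split=> [[-> E]|E].
  apply/eqP; rewrite -subr_eq0.
  have -> : m1 * (8 * a ^+ 3 - s ^+ 3) - a ^+ 3 * (8 - s ^+ 3) =
      4 * a ^+ 3 * s ^+ 3 * ((1 / 4 + 2 * m1 / s ^+ 3) -
        (m1 / (4 * a ^+ 3) + 2 / s ^+ 3)) by field; rewrite !gt_eqF.
  by rewrite E subrr mulr0.
have I0 : m1 * a ^+ 2 + 1 != 0.
  by have [a0 mu0] := (a_gt0, m1_gt0); rewrite gt_eqF //; nra.
have lam12 : m1 / (4 * a ^+ 3) + 2 / s ^+ 3 = 1 / 4 + 2 * m1 / s ^+ 3.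
  apply/eqP; rewrite -subr_eq0.
  have -> : m1 / (4 * a ^+ 3) + 2 / s ^+ 3 - (1 / 4 + 2 * m1 / s ^+ 3) =
      (a ^+ 3 * (8 - s ^+ 3) - m1 * (8 * a ^+ 3 - s ^+ 3)) /
      (4 * a ^+ 3 * s ^+ 3) by field; rewrite !gt_eqF.
  by rewrite E subrr mul0r.
suff -> : lam = 1 / 4 + 2 * m1 / s ^+ 3 by split.
apply: (mulIf I0); rewrite lamE lam12; ring.
Qed.

End Rhombus.

(** * Differential of the force at a rhombus *)

Section RhombusDifferential.
Variables (R : realType) (a m1 : R).
Hypotheses (a_gt0 : 0 < a) (m1_gt0 : 0 < m1).
Local Notation s := (side a).
Local Notation q := (rhombus a).
Local Notation m := (rhombus_mass m1).
Local Notation lam := (rhombus_multiplier a m1).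
Hypotheses (lam1 : lam = m1 / (4 * a ^+ 3) + 2 / s ^+ 3)
           (lam2 : lam = 1 / 4 + 2 * m1 / s ^+ 3).
Variable v : 'rV[R]_(4 + 2.*2).
(* Bodies are numbered from 1 here, as in the paper. *)
Local Notation x k := (body_pos v (body k.-1) 0 0).
Local Notation y k := (body_pos v (body k.-1) 0 1).

Lemma mass_center_rhombus_vary k :
  mass_center v m 0 k =
  (m1 * (body_pos v (body 0) 0 k + body_pos v (body 2) 0 k) +
   (body_pos v (body 1) 0 k + body_pos v (body 3) 0 k)) / (2 * (m1 + 1)).
Proof.
have mu0 := m1_gt0.
rewrite mxE summxE !sum_bodies /= !rowZE !rhombus_mass_val /=.
by field; rewrite gt_eqF //; lra.
Qed.

Lemma dinertia_rhombus :
  dinertia q v m = 2 * (m1 * a * (y 1 - y 3) + (x 4 - x 2)).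
Proof.
rewrite /dinertia mass_center_rhombus sum_bodies /= !subr0 !dotvE !rowBE.
by rewrite !rhombus_mass_val !rhombus_x !rhombus_y /=; ring.
Qed.

(** At a central configuration the differential of the potential is [- lam / 2] times that of the
    inertia. *)
Lemma dpotential_rhombus :
  dpotential q v m = - lam * (m1 * a * (y 1 - y 3) + (x 4 - x 2)).
Proof.
have s0 := side_gt0 a.
(* The [lam] in front of the vertical variations is expanded by [lam1], the one in front of the
   horizontal variations by [lam2]. *)
rewrite mulNr mulrDr {1}lam1 lam2.
rewrite /dpotential sum_bodies /= !sum_bodies /= !enorm_rhombus //.
rewrite /rhombus_dist /= !dotvE !rowBE !rhombus_mass_val !rhombus_x !rhombus_y /=.
by field; rewrite !gt_eqF.
Qed.

(** Quotient rule with [U = lam * I] and [dU = - lam * dI / 2], which combine to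
    [- 3 / 2 * lam * dI / I]. *)
Lemma dmultiplier_rhombus :
  dmultiplier q v m =
  - 3 * lam * (m1 * a * (y 1 - y 3) + (x 4 - x 2)) / (2 * (m1 * a ^+ 2 + 1)).
Proof.
have I0 : m1 * a ^+ 2 + 1 != 0.
  by have [a0 mu0] := (a_gt0, m1_gt0); rewrite gt_eqF //; nra.
have U : potential q m = lam * inertia q m.
  by rewrite /rhombus_multiplier divfK // inertia_rhombus_neq0.
rewrite /dmultiplier U dinertia_rhombus dpotential_rhombus inertia_rhombus.
by field.
Qed.

Lemma dcc_force_rhombus i k :
  dcc_force q v m i 0 k =
  m 0 i * (\sum_(j | j != i) m 0 j *
     ((body_pos v j 0 k - body_pos v i 0 k) / rhombus_dist a j i ^+ 3
      - 3 * ((body_pos q j 0 0 - body_pos q i 0 0) *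
             (body_pos v j 0 0 - body_pos v i 0 0) +
             (body_pos q j 0 1 - body_pos q i 0 1) *
             (body_pos v j 0 1 - body_pos v i 0 1))
        * (body_pos q j 0 k - body_pos q i 0 k) / rhombus_dist a j i ^+ 5)
   + dmultiplier q v m * body_pos q i 0 k
   + lam * (body_pos v i 0 k - mass_center v m 0 k)).
Proof.
rewrite /dcc_force mass_center_rhombus subr0 2!rowDE summxE 2!rowZE rowBE.
rewrite !mulrDr mulr_sumr.
congr (_ + _ + _); last by rewrite /rhombus_multiplier; ring.
  apply: eq_bigr => j _.
  by rewrite rowBE !rowZE !rowBE enorm_rhombus // dotvE !rowBE; ring.
by ring.
Qed.

Local Notation f i k := (dcc_force q v m i 0 k).

Fact side5 : s ^+ 5 = s ^+ 3 * (1 + a ^+ 2).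
Proof. by rewrite -side_sqr -exprD. Qed.

(** Plane where opposite bodies move together horizontally; the linear form on the right vanishes on
    translations. *)
Lemma dcc_force_trans_x :
  f (body 0) 0 + f (body 2) 0 - f (body 1) 0 - f (body 3) 0 =
  2 * m1 * (lam / (m1 + 1) - 2 / s ^+ 3 * (1 - 3 / (1 + a ^+ 2))) *
  (x 1 + x 3 - x 2 - x 4).
Proof.
have [a0 mu0 s0] := And3 a_gt0 m1_gt0 (side_gt0 a).
rewrite !dcc_force_rhombus !sum_bodies /= !rhombus_mass_val /rhombus_dist /=.
rewrite !mass_center_rhombus_vary !rhombus_x !rhombus_y side5 /=.
by field; rewrite !gt_eqF //; nra.
Qed.

Lemma dcc_force_trans_y :
  f (body 0) 1 + f (body 2) 1 - f (body 1) 1 - f (body 3) 1 =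
  2 * m1 * (lam / (m1 + 1) - 2 / s ^+ 3 * (1 - 3 * a ^+ 2 / (1 + a ^+ 2))) *
  (y 1 + y 3 - y 2 - y 4).
Proof.
have [a0 mu0 s0] := And3 a_gt0 m1_gt0 (side_gt0 a).
rewrite !dcc_force_rhombus !sum_bodies /= !rhombus_mass_val /rhombus_dist /=.
rewrite !mass_center_rhombus_vary !rhombus_x !rhombus_y side5 /=.
by field; rewrite !gt_eqF //; nra.
Qed.

(** Plane where opposite bodies move oppositely along their diagonal. Scaling has [y 1 - y 3] and
    [x 4 - x 2] in the ratio [a : 1], which the form on the right annihilates. *)
Lemma dcc_force_scale_y :
  f (body 0) 1 - f (body 2) 1 =
  m1 * (3 * lam / (m1 * a ^+ 2 + 1) - 6 / (s ^+ 3 * (1 + a ^+ 2))) *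
  ((y 1 - y 3) - a * (x 4 - x 2)).
Proof.
have [a0 mu0 s0] := And3 a_gt0 m1_gt0 (side_gt0 a).
rewrite !dcc_force_rhombus !sum_bodies /= !rhombus_mass_val /rhombus_dist /=.
rewrite !mass_center_rhombus_vary !rhombus_x !rhombus_y side5 /=.
rewrite dmultiplier_rhombus lam1; field; rewrite !gt_eqF //; nra.
Qed.

Lemma dcc_force_scale_x :
  f (body 3) 0 - f (body 1) 0 =
  - a * m1 * (3 * lam / (m1 * a ^+ 2 + 1) - 6 / (s ^+ 3 * (1 + a ^+ 2))) *
  ((y 1 - y 3) - a * (x 4 - x 2)).
Proof.
have [a0 mu0 s0] := And3 a_gt0 m1_gt0 (side_gt0 a).
rewrite !dcc_force_rhombus !sum_bodies /= !rhombus_mass_val /rhombus_dist /=.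
rewrite !mass_center_rhombus_vary !rhombus_x !rhombus_y side5 /=.
rewrite dmultiplier_rhombus lam2; field; rewrite !gt_eqF //; nra.
Qed.

(** Plane where opposite bodies move oppositely across their diagonal. Rotation has [x 1 - x 3] and
    [y 4 - y 2] in the ratio [- a : 1], which the form on the right annihilates. *)
Lemma dcc_force_rot_x :
  f (body 0) 0 - f (body 2) 0 =
  6 * m1 / (s ^+ 3 * (1 + a ^+ 2)) * ((x 1 - x 3) + a * (y 4 - y 2)).
Proof.
have [a0 mu0 s0] := And3 a_gt0 m1_gt0 (side_gt0 a).
rewrite !dcc_force_rhombus !sum_bodies /= !rhombus_mass_val /rhombus_dist /=.
rewrite !mass_center_rhombus_vary !rhombus_x !rhombus_y side5 /=.
rewrite lam1; field; rewrite !gt_eqF //; nra.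
Qed.

Lemma dcc_force_rot_y :
  f (body 3) 1 - f (body 1) 1 =
  a * (6 * m1 / (s ^+ 3 * (1 + a ^+ 2))) * ((x 1 - x 3) + a * (y 4 - y 2)).
Proof.
have [a0 mu0 s0] := And3 a_gt0 m1_gt0 (side_gt0 a).
rewrite !dcc_force_rhombus !sum_bodies /= !rhombus_mass_val /rhombus_dist /=.
rewrite !mass_center_rhombus_vary !rhombus_x !rhombus_y side5 /=.
rewrite lam2; field; rewrite !gt_eqF //; nra.
Qed.

End RhombusDifferential.

(** * Nondegeneracy *)

Section Nondegeneracy.
Variables (R : realType) (n : nat).
Implicit Types (q : 'rV[R]_(4 + n.*2)) (m : 'rV[R]_n.+2).

Lemma mul_symmetry_mx_x q (z : 'cV[R]_4) i :
  (symmetry_mx q *m z) (coord_idx i 0) 0 =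
  z (body 0) 0 - body_pos q i 0 1 * z (body 2) 0 +
  body_pos q i 0 0 * z (body 3) 0.
Proof.
rewrite mxE sum_bodies /= !mxE axis_idxK body_idxK /=.
by ring.
Qed.

Lemma mul_symmetry_mx_y q (z : 'cV[R]_4) i :
  (symmetry_mx q *m z) (coord_idx i 1) 0 =
  z (body 1) 0 + body_pos q i 0 0 * z (body 2) 0 +
  body_pos q i 0 1 * z (body 3) 0.
Proof.
rewrite mxE sum_bodies /= !mxE axis_idxK body_idxK /=.
by ring.
Qed.

(** The matrix is block triangular, so only its upper left block matters. A kernel vector of that
    block is an infinitesimal similarity vanishing at the first two bodies, which are distinct,
    hence it is zero. *)
Lemma change_of_basis_unit q : configuration q -> change_of_basis q \in unitmx.
Proof.
move=> cq; rewrite unitmxE det_lblock det1 mulr1 unitfE -det_tr.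
apply/negP => /det0P[u u0 uB]; case/eqP: u0.
have Bu0 (l : 'I_(4 + n.*2)) : (l < 4)%N -> (symmetry_mx q *m u^T) l 0 = 0.
  move=> l4; have -> : l = lshift _ (Ordinal l4) by exact: val_inj.
  have /matrixP/(_ (Ordinal l4) 0) : usubmx (symmetry_mx q *m u^T) = 0.
    by rewrite -mul_usub_mx -[LHS]trmxK trmx_mul trmxK uB trmx0.
  by rewrite !mxE.
have := Bu0 (coord_idx ord0 0) isT; have := Bu0 (coord_idx ord0 1) isT.
have := Bu0 (coord_idx (lift ord0 ord0) 0) isT.
have := Bu0 (coord_idx (lift ord0 ord0) 1) isT.
have uE c : u^T c 0 = u 0 c by rewrite mxE.
rewrite !mul_symmetry_mx_x !mul_symmetry_mx_y !uE.
have := configuration_enorm cq (neq_lift ord0 ord0 : ord0 != lift ord0 ord0).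
move/exprn_gt0 => /(_ 2%N); rewrite enorm_sqr dotvE !rowBE => d0 y1 x1 y0 x0.
apply/rowP => c; rewrite [RHS]mxE; move: d0 y1 x1 y0 x0.
set b := body_pos q ord0; set b' := body_pos q (lift ord0 ord0).
set u2 := u 0 (body 2); set u3 := u 0 (body 3).
move=> d0 y1 x1 y0 x0.
(* Subtracting the equations of the two bodies removes the translations; the remaining system in
   [u2] and [u3] has the squared distance of the bodies as determinant. *)
have dy : (b 0 0 - b' 0 0) * u2 + (b 0 1 - b' 0 1) * u3 = 0 by lra.
have dx : (b 0 0 - b' 0 0) * u3 - (b 0 1 - b' 0 1) * u2 = 0 by lra.
have c2 : u2 = 0.
  apply: (mulfI (lt0r_neq0 d0)); rewrite mulr0.
  transitivity ((b 0 0 - b' 0 0) * ((b 0 0 - b' 0 0) * u2 + (b 0 1 - b' 0 1) * u3)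
    - (b 0 1 - b' 0 1) * ((b 0 0 - b' 0 0) * u3 - (b 0 1 - b' 0 1) * u2)).
    by ring.
  by rewrite dy dx !mulr0 subr0.
have c3 : u3 = 0.
  apply: (mulfI (lt0r_neq0 d0)); rewrite mulr0.
  transitivity ((b 0 1 - b' 0 1) * ((b 0 0 - b' 0 0) * u2 + (b 0 1 - b' 0 1) * u3)
    + (b 0 0 - b' 0 0) * ((b 0 0 - b' 0 0) * u3 - (b 0 1 - b' 0 1) * u2)).
    by ring.
  by rewrite dy dx !mulr0 addr0.
move: y0 x0; rewrite c2 c3 !mulr0 !addr0 subr0 => c1 c0.
by elim/body_ind: c.
Qed.

(* [J2] is the matrix of the Jacobian on the quotient by the span of the
   symmetry vectors, in the basis given by the last coordinate vectors. *)
Lemma nondegenerate_ccP q m : configuration q ->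
  (forall (w : 'cV[R]_(n.*2)) (z : 'cV[R]_4),
     cc_jacobian q m *m col_mx 0 w = symmetry_mx q *m z -> w = 0) ->
  nondegenerate_cc q m.
Proof.
move=> cq injJ; have Pu := change_of_basis_unit cq.
rewrite /nondegenerate_cc -det_tr; apply/negP => /det0P[u u0 uJ].
case/eqP: u0; apply: trmx_inj; rewrite trmx0.
set P := change_of_basis q in Pu.
set X := invmx P *m cc_jacobian q m *m P.
have Jw : drsubmx X *m u^T = 0.
  by rewrite -[LHS]trmxK trmx_mul trmxK uJ trmx0.
have PE (z : 'cV[R]_4) (w : 'cV[R]_(n.*2)) :
    P *m col_mx z w = symmetry_mx q *m z + col_mx 0 w.
  rewrite -[symmetry_mx q]vsubmxK /P /change_of_basis mul_block_col mul_col_mx.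
  by rewrite add_col_mx mul0mx mul1mx.
(* For [u] in the kernel of [J2], the Jacobian sends [(0, u)] to the symmetry vector with
   coefficients [J1 u], where [J1] is the upper right block of [X]. *)
apply: (injJ _ (ursubmx X *m u^T)).
have <- : P *m col_mx 0 u^T = col_mx 0 u^T by rewrite PE mulmx0 add0r.
have <- : P *m col_mx (ursubmx X *m u^T) 0 = symmetry_mx q *m (ursubmx X *m u^T).
  by rewrite PE col_mx0 addr0.
have <- : X *m col_mx 0 u^T = col_mx (ursubmx X *m u^T) 0.
  by rewrite -[X]submxK mul_block_col !mulmx0 !add0r Jw submxK.
by rewrite /X !mulmxA mulmxV // mul1mx.
Qed.

End Nondegeneracy.

(** * Positivity of the factors and nondegeneracy of the rhombus *)

Section RhombusNondegenerate.
Variables (R : realType) (a m1 : R).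
Hypotheses (m1_gt0 : 0 < m1) (a_gt0 : 0 < a).
Hypotheses (a_lower : 1 < 3 * a ^+ 2) (a_upper : a ^+ 2 < 3).
Local Notation s := (side a).
Local Notation q := (rhombus a).
Local Notation m := (rhombus_mass m1).
Local Notation lam := (rhombus_multiplier a m1).

(** The two expressions give [lam > 2 / s ^+ 3] and [lam > 2 * m1 / s ^+ 3]; their average is
    [lam > (m1 + 1) / s ^+ 3]. *)
Lemma multiplier_trans_gt (lam1 : lam = m1 / (4 * a ^+ 3) + 2 / s ^+ 3)
    (lam2 : lam = 1 / 4 + 2 * m1 / s ^+ 3) (t : R) : t < 1 / 4 ->
  0 < lam / (m1 + 1) - 2 / s ^+ 3 * t.
Proof.
move=> t_lt; have [a0 mu0] := (a_gt0, m1_gt0).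
have u0 : 0 < (s ^+ 3)^-1 by rewrite invr_gt0 exprn_gt0 // side_gt0.
have r0 : 0 < m1 / (4 * a ^+ 3) by rewrite divr_gt0 // mulr_gt0 // exprn_gt0.
rewrite subr_gt0 ltr_pdivlMr; last by lra.
have m1u : 0 < m1 * (s ^+ 3)^-1 by rewrite mulr_gt0.
have : 2 * (s ^+ 3)^-1 * t * (m1 + 1) < 2 * (s ^+ 3)^-1 * (1 / 4) * (m1 + 1).
  by rewrite ltr_pM2r ?ltr_pM2l ?mulr_gt0 //; lra.
move: lam1 lam2 m1u; rewrite -!mulrA; lra.
Qed.

(** Over a common denominator the numerator contains [lam + a ^+ 2 * lam]. Expanding the first [lam]
    by [lam1] and the second by [lam2] cancels every term in [s], and what remains is positive. *)
Lemma multiplier_scale_gt (lam1 : lam = m1 / (4 * a ^+ 3) + 2 / s ^+ 3)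
    (lam2 : lam = 1 / 4 + 2 * m1 / s ^+ 3) :
  0 < 3 * lam / (m1 * a ^+ 2 + 1) - 6 / (s ^+ 3 * (1 + a ^+ 2)).
Proof.
have [a0 mu0] := (a_gt0, m1_gt0).
have a2 : 0 < a ^+ 2 by rewrite exprn_gt0.
have s3 : 0 < s ^+ 3 by rewrite exprn_gt0 // side_gt0.
have r0 : 0 < m1 / (4 * a ^+ 3) by rewrite divr_gt0 // mulr_gt0 // exprn_gt0.
have ma : 0 < m1 * a ^+ 2 by rewrite mulr_gt0.
have -> : 3 * lam / (m1 * a ^+ 2 + 1) - 6 / (s ^+ 3 * (1 + a ^+ 2)) =
    3 / ((m1 * a ^+ 2 + 1) * (1 + a ^+ 2)) *
    (lam + a ^+ 2 * lam - 2 / s ^+ 3 * (m1 * a ^+ 2 + 1)).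
  by field; rewrite !gt_eqF ?side_gt0 //; lra.
apply: mulr_gt0; first by rewrite divr_gt0 // mulr_gt0 //; lra.
rewrite {1}lam1 lam2.
have -> : m1 / (4 * a ^+ 3) + 2 / s ^+ 3 + a ^+ 2 * (1 / 4 + 2 * m1 / s ^+ 3) -
    2 / s ^+ 3 * (m1 * a ^+ 2 + 1) = m1 / (4 * a ^+ 3) + a ^+ 2 / 4.
  by field; rewrite !gt_eqF //; exact: side_gt0.
lra.
Qed.

(** Take a variation that fixes the first two bodies and whose image is a symmetry vector. Pairing
    the image with the vector [b] of each plane gives zero, but also a positive multiple of the
    pairing of [b] with the variation. Four independent linear equations result. *)
Lemma nondegenerate_rhombus :
  central_configuration q m -> nondegenerate_cc q m.
Proof.
move=> /cc_rhombusP[] // lam1 lam2.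
have [[a0 mu0] [al au]] := ((a_gt0, m1_gt0), (a_lower, a_upper)).
have s0 := side_gt0 a.
have cq := configuration_rhombus a_gt0.
have I0 := inertia_rhombus_neq0 a_gt0 m1_gt0.
apply: nondegenerate_ccP => // w z Jv.
set v := col_mx 0 w in Jv.
have f_x i : dcc_force q v^T m i 0 0 = (symmetry_mx q *m z) (coord_idx i 0) 0.
  by rewrite -Jv mul_jacobian // [RHS]mxE body_idxK axis_idxK.
have f_y i : dcc_force q v^T m i 0 1 = (symmetry_mx q *m z) (coord_idx i 1) 0.
  by rewrite -Jv mul_jacobian // [RHS]mxE body_idxK axis_idxK.
have v0 (i : 'I_4) (k : 'I_2) : (i < 2)%N -> body_pos v^T i 0 k = 0.
  move=> i2; rewrite 2!mxE.
  have l4 : (coord_idx i k < 4)%N.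
    by case: i i2 => [[|[|]]] //= _ _; case: k => [[|[|]]].
  have -> : coord_idx i k = lshift 4 (Ordinal l4) by exact: val_inj.
  by rewrite /v col_mxEu mxE.
have zero_factor (k d e : R) : 0 < k -> e = k * d -> e = 0 -> d = 0.
  by move=> k0 -> /eqP; rewrite mulf_eq0 gt_eqF //= => /eqP.
have simpl_f := (f_x, f_y, mul_symmetry_mx_x, mul_symmetry_mx_y, rhombus_x,
  rhombus_y).
have v00 k : body_pos v^T (body 0) 0 k = 0 by exact: v0.
have v01 k : body_pos v^T (body 1) 0 k = 0 by exact: v0.
set x3 : R := body_pos v^T (body 2) 0 0; set y3 : R := body_pos v^T (body 2) 0 1.
set x4 : R := body_pos v^T (body 3) 0 0; set y4 : R := body_pos v^T (body 3) 0 1.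
have m2 : 0 < 2 * m1 by lra.
have xE : x3 - x4 = 0.
  (* [3 / 4] is the value of [3 / (1 + a ^+ 2)] at the upper end [a ^+ 2 = 3]. *)
  have tx : 1 - 3 / (1 + a ^+ 2) < 1 / 4.
    have : 3 / 4 < 3 / (1 + a ^+ 2) by rewrite ltr_pdivlMr; nra.
    lra.
  have := zero_factor _ _ _ (mulr_gt0 m2 (multiplier_trans_gt lam1 lam2 tx))
    (dcc_force_trans_x a_gt0 m1_gt0 v^T).
  rewrite !simpl_f /= !v00 !v01 -/x3 -/x4 -/y3 -/y4 => E; rewrite -[RHS]E; ring.
have yE : y3 - y4 = 0.
  have ty : 1 - 3 * a ^+ 2 / (1 + a ^+ 2) < 1 / 4.
    have : 3 / 4 < 3 * a ^+ 2 / (1 + a ^+ 2) by rewrite ltr_pdivlMr; nra.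
    lra.
  have := zero_factor _ _ _ (mulr_gt0 m2 (multiplier_trans_gt lam1 lam2 ty))
    (dcc_force_trans_y a_gt0 m1_gt0 v^T).
  rewrite !simpl_f /= !v00 !v01 -/x3 -/x4 -/y3 -/y4 => E; rewrite -[RHS]E; ring.
have sE : y3 + a * x4 = 0.
  have := dcc_force_scale_y a_gt0 m1_gt0 lam1 lam2 v^T.
  have := dcc_force_scale_x a_gt0 m1_gt0 lam1 lam2 v^T.
  (* [1 + a ^+ 2] is the squared length of [b = (1, - a)], with which the two equations are paired
     below. *)
  have a2 : 0 < (1 + a ^+ 2) * m1 by rewrite mulr_gt0 //; nra.
  have := mulr_gt0 a2 (multiplier_scale_gt lam1 lam2).
  rewrite !simpl_f /= !v00 !v01 -/x3 -/x4 -/y3 -/y4.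
  set K := 3 * _ / _ - _ => K0 Ex Ey.
  apply: (zero_factor _ _ _ K0 (erefl _)).
  transitivity (- (m1 * K * (0 - y3 - a * (x4 - 0))) +
                a * (- a * m1 * K * (0 - y3 - a * (x4 - 0)))); first by ring.
  by rewrite -Ex -Ey; ring.
have rE : a * y4 - x3 = 0.
  have a2 : 0 < 1 + a ^+ 2 by nra.
  have := dcc_force_rot_x a_gt0 m1_gt0 lam1 v^T.
  have := dcc_force_rot_y a_gt0 m1_gt0 lam2 v^T.
  have : 0 < (1 + a ^+ 2) * (6 * m1 / (s ^+ 3 * (1 + a ^+ 2))).
    by rewrite mulr_gt0 // divr_gt0 // mulr_gt0 ?exprn_gt0.
  rewrite !simpl_f /= !v00 !v01 -/x3 -/x4 -/y3 -/y4.
  set K := _ / (_ * _) => K0 Ey Ex.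
  apply: (zero_factor _ _ _ K0 (erefl _)).
  transitivity (K * (0 - x3 + a * (y4 - 0)) +
                a * (a * K * (0 - x3 + a * (y4 - 0)))); first by ring.
  by rewrite -Ex -Ey; ring.
(* The four relations chain to [y4 = y3 = - a * x4 = - a * x3 = - a ^+ 2 * y4]. *)
have y40 : y4 = 0 by nra.
have x40 : x4 = 0 by nra.
have x30 : x3 = 0 by lra.
have y30 : y3 = 0 by lra.
have body0 i k : body_pos v^T i 0 k = 0.
  by elim/body_ind: i; elim/axis_ind: k.
have : v = 0.
  apply/colP => l; rewrite [RHS]mxE -(coord_idxK l).
  by have := body0 (body_idx l) (axis_idx l); rewrite 2!mxE.
by rewrite /v -[RHS]col_mx0 => /eq_col_mx[].
Qed.

End RhombusNondegenerate.

(** * Existence and uniqueness *)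

Lemma side_lt {R : realType} (a b : R) : 0 < a -> a < b -> side a < side b.
Proof. by move=> a0 ab; rewrite ltr_sqrt; nra. Qed.

(** [side a / a] is the square root of [1 + a ^- 2]; the proof clears denominators and compares
    squares. *)
Lemma side_div_lt {R : realType} (a b : R) : 0 < a -> a < b ->
  side b / b < side a / a.
Proof.
move=> a0 ab; have b0 : 0 < b by lra.
have [sa sb] := (side_gt0 a, side_gt0 b).
rewrite ltr_pdivrMr // mulrAC ltr_pdivlMr //.
rewrite -(@ltr_pXn2r _ 2) ?nnegrE ?mulr_ge0 ?ltW //.
rewrite !exprMn !side_sqr; nra.
Qed.

(* Dividing by [a ^+ 3], the equation reads
   [m1 * (8 - (side a / a) ^+ 3) = 8 - side a ^+ 3], whose left-hand side
   increases with [a] while the right-hand side decreases. *)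
Lemma rhombus_equation_uniq (R : realType) (m1 a b : R) :
  0 < m1 -> 0 < a ->
  m1 * (8 * a ^+ 3 - side a ^+ 3) = a ^+ 3 * (8 - side a ^+ 3) ->
  m1 * (8 * b ^+ 3 - side b ^+ 3) = b ^+ 3 * (8 - side b ^+ 3) ->
  ~~ (a < b).
Proof.
move=> mu0 a0 Ea Eb; apply/negP => ab; have b0 : 0 < b by lra.
have divE (c : R) : 0 < c ->
    m1 * (8 * c ^+ 3 - side c ^+ 3) = c ^+ 3 * (8 - side c ^+ 3) ->
    m1 * (8 - (side c / c) ^+ 3) = 8 - side c ^+ 3.
  move=> c0 Ec; have c3 : c ^+ 3 != 0 by rewrite expf_neq0 // gt_eqF.
  apply: (mulfI c3); rewrite -Ec; field; exact: lt0r_neq0.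
have := divE _ a0 Ea; have := divE _ b0 Eb.
have : side a ^+ 3 < side b ^+ 3.
  by rewrite ltr_pXn2r ?nnegrE ?sqrtr_ge0 // side_lt.
have : (side b / b) ^+ 3 < (side a / a) ^+ 3.
  rewrite ltr_pXn2r ?nnegrE ?divr_ge0 ?sqrtr_ge0 ?(ltW a0) ?(ltW b0) //.
  exact: side_div_lt.
move: (side a ^+ 3) (side b ^+ 3) (_ ^+ 3) (_ ^+ 3) => sa sb ra rb; nra.
Qed.

Lemma sqrt3_bounds (R : realType) (a : R) : Num.sqrt 3 / 3 < a < Num.sqrt 3 ->
  [/\ 0 < a, 1 < 3 * a ^+ 2 & a ^+ 2 < 3].
Proof.
have r0 : 0 < Num.sqrt 3 :> R by rewrite sqrtr_gt0.
have r2 : Num.sqrt 3 ^+ 2 = 3 :> R by rewrite sqr_sqrtr.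
by case/andP => la ua; split; nra.
Qed.

Lemma continuous_side (R : realType) : continuous (@side R).
Proof.
move=> a; apply: (@continuous_comp _ _ _ (fun x : R => 1 + x ^+ 2) Num.sqrt).
  by apply: continuousD; [exact: cst_continuous | exact: exprn_continuous].
exact: sqrt_continuous.
Qed.

Lemma rhombus_equation_exists (R : realType) (m1 : R) : 0 < m1 ->
  exists2 a : R, Num.sqrt 3 / 3 < a < Num.sqrt 3 &
  m1 * (8 * a ^+ 3 - side a ^+ 3) = a ^+ 3 * (8 - side a ^+ 3).
Proof.
move=> mu0; set r : R := Num.sqrt 3.
have r0 : 0 < r by rewrite sqrtr_gt0.
have r2 : r ^+ 2 = 3 by rewrite sqr_sqrtr.
pose g (a : R) := m1 * (8 * a ^+ 3 - side a ^+ 3) - a ^+ 3 * (8 - side a ^+ 3).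
(* At each end of the interval the side equals one diagonal, three bodies form an equilateral
   triangle, and one side of the equation vanishes; this leaves the sign of [g] visible. *)
have side_r : side r = 2.
  by rewrite /side r2 (_ : 1 + 3 = 2 ^+ 2); [rewrite sqrtr_sqr ger0_norm | ring].
have side_r3 : side (r / 3) = 2 * (r / 3).
  rewrite /side (_ : 1 + (r / 3) ^+ 2 = (2 * (r / 3)) ^+ 2).
    by rewrite sqrtr_sqr ger0_norm //; lra.
  by rewrite !exprMn r2; field.
have r3 : r ^+ 3 = 3 * r by rewrite exprS r2 mulrC.
have gr : 0 < g r.
  by rewrite /g side_r r3; nra.
have gr3 : g (r / 3) < 0.
  rewrite /g side_r3 !exprMn r3; nra.
have g_cont : continuous g.
  have cX : continuous (fun x : R => x ^+ 3) by exact: exprn_continuous.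
  have cS : continuous (fun x : R => side x ^+ 3).
    move=> x; apply: (@continuous_comp _ _ _ (@side R) (fun y : R => y ^+ 3)).
      exact: continuous_side.
    exact: cX.
  move=> x; rewrite /g; apply: cvgB; apply: cvgM.
  - exact: cvg_cst.
  - apply: cvgB; last exact: cS.
    by apply: cvgM; [exact: cvg_cst | exact: cX].
  - exact: cX.
  - by apply: cvgB; [exact: cvg_cst | exact: cS].
have [||a] := @IVT R g (r / 3) r 0 _ (continuous_subspaceT g_cont).
- by lra.
- by rewrite ge_min le_max (ltW gr3) (ltW gr) orbT.
rewrite in_itv /= => /andP[la ua] ga0; exists a; last exact: subr0_eq.
(* The intermediate value theorem yields a point of the closed interval; the strict signs of [g] at
   the ends exclude them. *)
rewrite !lt_neqAle la ua !andbT; apply/andP; split.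
  by apply: contraTneq gr3 => ->; rewrite ga0 ltxx.
by apply: contraTneq gr => <-; rewrite ga0 ltxx.
Qed.

Theorem theorem4p1 (R : realType) (m1 : R) (m1_gt0 : 0 < m1) :
  (exists! a : R,
     Num.sqrt 3 / 3 < a < Num.sqrt 3 /\
     central_configuration (rhombus a) (rhombus_mass m1)) /\
  (forall a : R,
     Num.sqrt 3 / 3 < a < Num.sqrt 3 ->
     central_configuration (rhombus a) (rhombus_mass m1) ->
     nondegenerate_cc (rhombus a) (rhombus_mass m1)).
Proof.
split; last first.
  by move=> a /sqrt3_bounds[a0 al au]; exact: nondegenerate_rhombus.
have [a a_bounds Ea] := rhombus_equation_exists m1_gt0.
have [a0 _ _] := sqrt3_bounds a_bounds.
exists a; split=> [|b [/sqrt3_bounds[b0 _ _] /cc_rhombusE Eb]].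
  by split=> //; apply/cc_rhombusE.
(* The uniqueness lemma excludes only one strict order, so it is used once in each direction. *)
apply: le_anti; rewrite !leNgt; apply/andP; split.
  exact: rhombus_equation_uniq (Eb b0 m1_gt0) Ea.
exact: rhombus_equation_uniq Ea (Eb b0 m1_gt0).
Qed.
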